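(* Assume (S1) and let $\beta$ be given by (K1) or (K2). For any $J\in\mathbb Z^+$, any $\Delta t>0$, any $N$ (with $N\Delta t=T\le\infty$) and any given $\vec U^0,\vec U^1\in\mathbb R^{J-1}$, the fully discrete scheme (FD) has a solution $\vec U^2,\vec U^3,\dots,\vec U^N$, i.e. at each level $n\ge2$, given $\vec U^0,\dots,\vec U^{n-1}$, the (nonlinear) equation (FD) for $\vec U^n$ has at least one solution in $\mathbb R^{J-1}$.
   Context: Kernels: (K1) $\beta(t)=e^{-\sigma t}t^{\alpha-1}\cos(\gamma t)/\Gamma(\alpha)$ with $\sigma>1$, $0\le\gamma\le\sigma$, $\alpha\in\{1/2,1\}$; (K2) $\beta(t)=e^{-\sigma t}t^{\alpha-1}/\Gamma(\alpha)$ with $\sigma>1$, $0<\alpha\le1$. $K(t)=\int_t^\infty\beta(s)ds$, $K_0=K(0)<1$, $\mu_0=1-K_0$. Assumption (S1): $G:[0,\infty)\to(0,\infty)$ is continuous with $G(v)\ge g_0>0$ for all $v\ge0$, and $G$ is bounded on bounded sets. Grid: $h=1/J$, $x_j=jh$. For $\vec W=(W_1,\dots,W_{J-1})^\top$ extended by $W_0=W_J=0$, $W_{-1}=-W_1$, $W_{J+1}=-W_{J-1}$: $(W_j)_{x\bar x}=(W_{j+1}-2W_j+W_{j-1})/h^2$, $(W_j)_{xx\bar x\bar x}=(W_{j+2}-4W_{j+1}+6W_j-4W_{j-1}+W_{j-2})/h^4$. $\langle\vec V,\vec W\rangle=h\sum_{j=1}^{J-1}V_jW_j$, $\|\vec W\|=\langle\vec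 W,\vec W\rangle^{1/2}$. Time grid: $t_n=n\Delta t$, $\delta_t U^n=(U^n-U^{n-1})/\Delta t$, $\delta_t^2U^n=\delta_t(\delta_tU^n)$. Weights $w_{np}=\frac1{\Delta t}\int_{t_{n-1}}^{t_n}\int_{t_{p-1}}^{\min(t,t_p)}K(t-s)\,ds\,dt>0$, $1\le p\le n$. Fully discrete scheme (FD): for $n\ge2$, $j=1,\dots,J-1$: $\delta_t^2U_j^n+G(\|\vec U^n_{x\bar x}\|^2)\delta_tU_j^n+\mu_0(U_j^n)_{xx\bar x\bar x}+\sum_{p=1}^n w_{np}(\delta_tU_j^p)_{xx\bar x\bar x}=f(x_j,t_n)-K(t_n)(U_j^0)_{xx\bar x\bar x}$, with boundary conventions $U_0^n=U_J^n=0$, $U_{-1}^n=-U_1^n$, $U_{J+1}^n=-U_{J-1}^n$. *)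

(* Defs.v *)
From HB Require Import structures.
From mathcomp Require Import all_boot all_order all_algebra.
From mathcomp Require Import all_classical all_reals all_analysis.
Set Implicit Arguments.
Unset Strict Implicit.
Unset Printing Implicit Defensive.
Import Order.TTheory GRing.Theory Num.Theory.
Import numFieldNormedType.Exports.
Local Open Scope classical_set_scope.
Local Open Scope ring_scope.

Section Defs.
Variable R : realType.

Definition Gamma (a : R) : R :=
  \int[lebesgue_measure]_(x in `]0, +oo[) (x `^ (a - 1) * expR (- x)).

Definition betaK1 (sigma gamma alpha : R) (t : R) : R :=
  expR (- sigma * t) * t `^ (alpha - 1) * cos (gamma * t) / Gamma alpha.

Definition betaK2 (sigma alpha : R) (t : R) : R :=
  expR (- sigma * t) * t `^ (alpha - 1) / Gamma alpha.

Definition admissible_kernel (beta : R -> R) : Prop :=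
  (exists sigma gamma alpha : R,
      1 < sigma /\ 0 <= gamma <= sigma /\ (alpha = 2^-1 \/ alpha = 1) /\
      beta = betaK1 sigma gamma alpha)
  \/
  (exists sigma alpha : R,
      1 < sigma /\ 0 < alpha <= 1 /\ beta = betaK2 sigma alpha).

Definition Kker (beta : R -> R) (t : R) : R :=
  \int[lebesgue_measure]_(s in `[t, +oo[) beta s.

Definition S1 (G : R -> R) : Prop :=
  {within `[0, +oo[, continuous G} /\
  (forall v, 0 <= v -> 0 < G v) /\
  (exists g0 : R, 0 < g0 /\ forall v, 0 <= v -> g0 <= G v) /\
  (forall M : R, exists B : R, forall v, 0 <= v <= M -> G v <= B).

Definition wgt (beta : R -> R) (dt : R) (n p : nat) : R :=
  dt^-1 * \int[lebesgue_measure]_(t in `[(n.-1)%:R * dt, n%:R * dt])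
     (\int[lebesgue_measure]_(s in `[(p.-1)%:R * dt, Num.min t (p%:R * dt)])
         Kker beta (t - s)).

(* grid vectors in R^{J-1}: components W_1, ..., W_{J-1},
   stored as W : 'I_(J.-1) -> R with W_j = W (j-1) *)
Definition gvec (J : nat) := 'I_(J.-1) -> R.

(* interior node value W_k, 1 <= k <= J-1 (0 elsewhere, only used inside) *)
Definition node (J : nat) (W : gvec J) (k : nat) : R :=
  if (1 <= k)%N then (if @insub _ (fun i => i < J.-1)%N _ k.-1 is Some i
                      then W i else 0) else 0.

Definition gext (J : nat) (W : gvec J) (j : int) : R :=
  if j == (-1)%R then - node W 1
  else if j == (J.+1)%:Z then - node W J.-1
  else match j with
       | Posz k => if (k == 0)%N || (k == J) then 0 else node W k
       | Negz _ => 0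
       end.

Definition hstep (J : nat) : R := (J%:R)^-1.

Definition dxx (J : nat) (W : gvec J) (j : int) : R :=
  (gext W (j + 1) - 2 * gext W j + gext W (j - 1)) / hstep J ^+ 2.

Definition dxxxx (J : nat) (W : gvec J) (j : int) : R :=
  (gext W (j + 2) - 4 * gext W (j + 1) + 6 * gext W j
   - 4 * gext W (j - 1) + gext W (j - 2)) / hstep J ^+ 4.

Definition vdxx (J : nat) (W : gvec J) : gvec J :=
  fun i => dxx W (i.+1)%:Z.

Definition gdot (J : nat) (V W : gvec J) : R :=
  hstep J * \sum_(i < J.-1) V i * W i.

Definition gnorm2 (J : nat) (W : gvec J) : R := gdot W W.

Definition dtv (J : nat) (dt : R) (U : nat -> gvec J) (p : nat) : gvec J :=
  fun i => (U p i - U p.-1 i) / dt.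

Definition FD_eq (beta G : R -> R) (f : R -> R -> R) (J : nat) (dt : R)
    (U : nat -> gvec J) (n : nat) (i : 'I_(J.-1)) : Prop :=
  let j : int := (i.+1)%:Z in
  let K0 := Kker beta 0 in
  let mu0 := 1 - K0 in
  (U n i - 2 * U n.-1 i + U n.-2 i) / dt ^+ 2
  + G (gnorm2 (vdxx (U n))) * ((U n i - U n.-1 i) / dt)
  + mu0 * dxxxx (U n) j
  + \sum_(1 <= p < n.+1) wgt beta dt n p * dxxxx (dtv dt U p) j
  = f (i.+1%:R * hstep J) (n%:R * dt) - Kker beta (n%:R * dt) * dxxxx (U 0%N) j.

End Defs.

(* Main.v *)
Require Import Defs.
From HB Require Import structures.
From mathcomp Require Import all_boot all_order all_algebra.
From mathcomp Require Import all_classical all_reals all_analysis measurable_realfun.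
From mathcomp Require Import ring lra zify.
Import Order.TTheory GRing.Theory Num.Theory.
Import numFieldNormedType.Exports.
Local Open Scope classical_set_scope.
Local Open Scope ring_scope.

(**
At level n, put B = vdxx, a symmetric matrix with dxxxx = B^2.  For a frozen
value g of G / dt, the scheme is the linear equation
   (a + g) V + c B^2 V = F + g U^(n-1),   a = dt^-2,  c = mu0 + w_nn / dt.
Since |beta| is dominated by a Gamma density, K >= K_0 - 1 = - mu0, hence
w_nn >= - mu0 dt and c >= 0.  The equation therefore has a unique solution V(g),
and B V(g) is bounded and locally Lipschitz in g >= 0.  As the nonlinearity only depends on the scalar
s = h |B V|^2, solving the scheme amounts to finding a fixed point of
s |-> h |B V(G(s) / dt)|^2, a continuous map of some [0, M] into itself: the
intermediate value theorem replaces Brouwer's.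
*)

(** * Lower bounds for real-valued integrals *)

(* Used on the inner integrals of [wgt]: it spares proving that [Kker beta] is
   measurable. *)
Lemma ge0_le_integral_nonmeasurable d (T : measurableType d) (R : realType)
    (mu : {measure set T -> \bar R}) (D : set T) (f1 f2 : T -> \bar R) :
  (forall x, D x -> (0 <= f1 x)%E) -> (forall x, D x -> (f1 x <= f2 x)%E) ->
  (\int[mu]_(x in D) f1 x <= \int[mu]_(x in D) f2 x)%E.
Proof.
move=> f10 f12.
have f20 x : D x -> (0 <= f2 x)%E by move=> Dx; apply: le_trans (f10 _ Dx) (f12 _ Dx).
rewrite !ge0_integralE//; apply: le_ereal_sup => _ [h hf <-]; exists h => //= x.
by apply: le_trans (hf x) _; apply: lee_restrict.
Qed.

(** The negative part of [f] is at most [m] on [D], so its integral is finite. If the positive part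
    has infinite integral, the real-valued integral takes the default 0, which still lies above the
    nonpositive bound. *)
Lemma Rintegral_ge_cst d (T : measurableType d) (R : realType)
    (mu : {measure set T -> \bar R}) (D : set T) (f : T -> R) (m : R) :
  d.-measurable%classic D -> (mu D < +oo)%E -> 0 <= m ->
  (forall x, D x -> - m <= f x) ->
  - (m * fine (mu D)) <= \int[mu]_(x in D) f x.
Proof.
move=> mD fD m0 fm; rewrite /Rintegral integralE.
set P := (\int[mu]_(x in D) _)%E; set N := (\int[mu]_(x in D) _)%E.
have P0 : (0 <= P)%E by apply: integral_ge0.
have N0 : (0 <= N)%E by apply: integral_ge0.
have NE : (N <= (m * fine (mu D))%:E)%E.
  rewrite EFinM fineK; last by rewrite ge0_fin_numE.
  rewrite -integral_cst//; apply: ge0_le_integral_nonmeasurable => // x Dx.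
  rewrite funenegE ge_max -EFinN !lee_fin m0 andbT lerNl; exact: fm.
move: P0 N0 NE; case: P => [p| |] //; case: N => [n| |] //=; rewrite ?lee_fin => p0 n0 nm.
  lra.
rewrite oppr_le0; apply: le_trans n0 nm.
Qed.

Lemma fine_lebesgue_itvcc (R : realType) (a b : R) : a <= b ->
  fine (lebesgue_measure `[a, b]%classic) = b - a.
Proof.
rewrite lebesgue_measure_itv /= lte_fin le_eqVlt => /predU1P[->|->] //=.
by rewrite ltxx subrr.
Qed.

Lemma Rintegral_ge_itv (R : realType) (f : R -> R) (a b m : R) :
  a <= b -> 0 <= m -> (forall x, a <= x <= b -> - m <= f x) ->
  - (m * (b - a)) <= \int[lebesgue_measure]_(x in `[a, b]) f x.
Proof.
move=> ab m0 fm; rewrite -(fine_lebesgue_itvcc _ _ _ ab).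
apply: Rintegral_ge_cst => //.
  rewrite [X in (X < _)%E](lebesgue_measure_itv `[a, b]) /=.
  by case: ifP => _; rewrite ?ltry// -EFinB ltry.
Qed.

(** * Gamma domination of the kernels and the diagonal weight *)

Definition gamma_density {R : realType} (alpha t : R) : R :=
  expR (- t) * t `^ (alpha - 1) / Gamma alpha.

Lemma Gamma_ge0 (R : realType) (alpha : R) : 0 <= Gamma alpha.
Proof. by apply: Rintegral_ge0 => x _; rewrite mulr_ge0 ?powR_ge0 ?expR_ge0. Qed.

Lemma gamma_density_ge0 (R : realType) (alpha t : R) : 0 <= gamma_density alpha t.
Proof. by rewrite /gamma_density divr_ge0 ?Gamma_ge0 // mulr_ge0 ?powR_ge0 ?expR_ge0. Qed.

Lemma measurable_gamma_integrand (R : realType) (alpha : R) :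
  measurable_fun [set: R] (fun x : R => x `^ (alpha - 1) * expR (- x)).
Proof.
apply: measurable_funM; first exact: measurable_powR.
by apply: measurableT_comp => //; exact: measurableT_comp.
Qed.

(** [Gamma] is the [fine] of a nonnegative integral, so a nonzero value certifies convergence,
    divergence being sent to 0. When [Gamma alpha] is 0, division by zero makes the density
    identically 0. *)
Lemma integrable_gamma_density (R : realType) (alpha : R) :
  (@lebesgue_measure R).-integrable `[0, +oo[ (EFin \o gamma_density alpha).
Proof.
have E : gamma_density alpha = fun x => (x `^ (alpha - 1) * expR (- x)) * (Gamma alpha)^-1.
  by apply/funext => x; rewrite /gamma_density [X in X / _]mulrC.
have [G0|Gn0] := eqVneq (Gamma alpha) 0.
  rewrite E G0 invr0 (_ : _ \o _ = cst 0%E); first exact: integrable0.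
  by apply/funext => x /=; rewrite mulr0.
have mf := measurable_gamma_integrand R alpha.
have If : (@lebesgue_measure R).-integrable `[0, +oo[
    (EFin \o (fun x : R => x `^ (alpha - 1) * expR (- x))).
  apply/integrableP; split; first by apply/measurable_EFinP; exact: measurable_funTS.
  rewrite -integral_itv_obnd_cbnd; last first.
    by apply/measurableT_comp => //; apply/measurable_EFinP; exact: measurable_funTS.
  move: Gn0; rewrite /Gamma /Rintegral.
  under [X in (X < _)%E]eq_integral do rewrite /= ger0_norm ?mulr_ge0 ?powR_ge0 ?expR_ge0//.
  have := integral_ge0 lebesgue_measure (D := `]0,+oo[%classic)
     (f := fun x : R => (x `^ (alpha - 1) * expR (- x))%:E).
  case: integral => [r _ _| _ |] //=; first by rewrite ltry.
    by rewrite eqxx.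
rewrite E (_ : _ \o _ = fun x => ((Gamma alpha)^-1%:E * (x `^ (alpha - 1) * expR (- x))%:E)%E).
  exact: integrableZl.
by apply/funext => x /=; rewrite mulrC EFinM.
Qed.

(** The mass is 1, or 0 in the degenerate case [Gamma alpha = 0]; the inequality covers both. *)
Lemma Rintegral_gamma_density_le1 (R : realType) (alpha : R) :
  \int[lebesgue_measure]_(t in `[0, +oo[) gamma_density alpha t <= 1.
Proof.
have [G0|Gn0] := eqVneq (Gamma alpha) 0.
  rewrite /gamma_density G0.
  under eq_Rintegral do rewrite invr0 mulr0.
  by rewrite /Rintegral integral0.
rewrite /gamma_density /Rintegral.
under eq_integral do rewrite mulrC [X in _ * X]mulrC EFinM.
have mf := measurable_gamma_integrand R alpha.
rewrite ge0_integralZl//=; last 3 first.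
- by apply/measurable_EFinP; exact: measurable_funTS.
- by move=> x _; rewrite lee_fin mulr_ge0 ?powR_ge0 ?expR_ge0.
- by rewrite lee_fin invr_ge0 Gamma_ge0.
rewrite -integral_itv_obnd_cbnd; last first.
  by apply/measurable_EFinP; exact: measurable_funTS.
move: Gn0; rewrite /Gamma /Rintegral.
case: integral => [r|  |] //= Gn0; rewrite ?mulr0 ?eqxx//.
by rewrite mulVf.
Qed.

(** [K(0) - K(r)] is the integral of [beta] over [[0, r[], hence at most that of [|beta|], hence at
    most the total mass of a dominating density. Passing through [|beta|] admits the oscillating
    kernel. *)
Lemma Kker_ge (R : realType) (beta : R -> R) (hbeta : admissible_kernel beta) (r : R) :
  0 <= r -> Kker beta 0 - 1 <= Kker beta r.
Proof.
move=> r0.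
(* The density has the exponent of the kernel: [sigma > 1] gives [exp(-sigma t) <= exp(-t)], and the
   cosine is at most 1 in modulus. *)
have [alpha [mbeta Hb]] : exists alpha, measurable_fun setT beta /\
    forall t, 0 <= t -> `|beta t| <= gamma_density alpha t.
  have me (s : R) : measurable_fun setT (fun t => expR (- s * t)).
    by apply: measurableT_comp => //; exact: measurableT_comp.
  have ee (s t : R) : 1 < s -> 0 <= t -> expR (- s * t) <= expR (- t).
    by move=> s1 t0; rewrite ler_expR mulNr lerN2 ler_peMl // ltW.
  case: hbeta => [[s [g [a [s1 [_ [_ ->]]]]]]|[s [a [s1 [_ ->]]]]]; exists a; split.
  - apply: measurable_funM => //; apply: measurable_funM.
      by apply: measurable_funM => //; exact: measurable_powR.
    apply: (measurableT_comp (f := @cos R)); last exact: mulrl_measurable.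
    by apply: continuous_measurable_fun; exact: continuous_cos.
  - move=> t t0; rewrite /betaK1 /gamma_density !normrM normfV (ger0_norm (Gamma_ge0 _ _)).
    rewrite ler_wpM2r ?invr_ge0 ?Gamma_ge0// ger0_norm ?expR_ge0// ger0_norm ?powR_ge0//.
    rewrite -[leRHS]mulr1 ler_pM ?mulr_ge0 ?expR_ge0 ?powR_ge0 ?cos_max//.
    by rewrite ler_wpM2r ?powR_ge0 ?ee.
  - apply: measurable_funM => //.
    by apply: measurable_funM => //; exact: measurable_powR.
  - move=> t t0; rewrite /betaK2 /gamma_density !normrM normfV (ger0_norm (Gamma_ge0 _ _)).
    rewrite ler_wpM2r ?invr_ge0 ?Gamma_ge0// ger0_norm ?expR_ge0// ger0_norm ?powR_ge0//.
    by rewrite ler_wpM2r ?powR_ge0 ?ee.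
have Ig := integrable_gamma_density R alpha.
have Ib : (@lebesgue_measure R).-integrable `[0, +oo[ (EFin \o beta).
  apply: le_integrable Ig => //.
    by apply/measurable_EFinP; exact: measurable_funTS.
  move=> x /=; rewrite in_itv /= andbT => x0.
  by rewrite lee_fin [leRHS]ger0_norm ?gamma_density_ge0 ?Hb.
have S : (`[0%R, r[ `<=` `[0%R, +oo[)%classic.
  by move=> x /=; rewrite !in_itv /= andbT => /andP[].
have Ib' : (@lebesgue_measure R).-integrable `[0, r[ (EFin \o beta) by apply: integrableS Ib.
have Ig' : (@lebesgue_measure R).-integrable `[0, r[ (EFin \o gamma_density alpha).
  by apply: integrableS Ig.
have U : (`[0%R, +oo[ = `[0%R, r[ `|` `[r, +oo[)%classic.
  by rewrite -itv_bndbnd_setU // bnd_simp.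
have D : [disjoint `[0%R, r[ & `[r, +oo[]%classic.
  apply/disj_setPS => y [/=]; rewrite !in_itv/= andbT => /andP[_ yr].
  by rewrite leNgt yr.
have -> : Kker beta 0 = \int[lebesgue_measure]_(t in `[0, r[) beta t + Kker beta r.
  by rewrite /Kker U Rintegral_setU// -U.
rewrite addrAC gerDr subr_le0 (le_trans _ (Rintegral_gamma_density_le1 R alpha))//.
apply: (le_trans (ler_norm _)); apply: (le_trans (le_normr_Rintegral _ Ib')) => //.
rewrite [leRHS](_ : _ = \int[lebesgue_measure]_(t in `[0, r[) gamma_density alpha t +
    \int[lebesgue_measure]_(t in `[r, +oo[) gamma_density alpha t); last first.
  by rewrite U Rintegral_setU// -U.
apply: ler_wpDr; first by apply: Rintegral_ge0 => x _; exact: gamma_density_ge0.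
apply: le_Rintegral => //.
  exact: (integrable_norm Ib').
by move=> x /=; rewrite in_itv /= => /andP[x0 _]; exact: Hb.
Qed.

(** With [K >= -m], the inner integral runs over a length [t - a <= dt] and is at least [-m dt]; the
    outer one has length [dt]. The two divisions by [dt] leave exactly [-m]. *)
Lemma wgt_diag_ge (R : realType) (beta : R -> R) (hbeta : admissible_kernel beta)
    (hK0 : Kker beta 0 < 1) (dt : R) (hdt : 0 < dt) (n : nat) : (0 < n)%N ->
  0 <= 1 - Kker beta 0 + wgt beta dt n n / dt.
Proof.
case: n => // n _; rewrite /wgt /= -!natr1 mulrDl mul1r.
set a := n%:R * dt; have m0 : 0 <= 1 - Kker beta 0 by rewrite subr_ge0 ltW.
set m := 1 - Kker beta 0.
have inner t : a <= t <= a + dt -> - (m * dt) <=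
    \int[lebesgue_measure]_(s in `[a, Num.min t (a + dt)]) Kker beta (t - s).
  move=> /andP[at_ tb]; rewrite min_l//.
  apply: (@le_trans _ _ (- (m * (t - a)))).
    by rewrite lerN2 ler_wpM2l// lerBlDl.
  apply: Rintegral_ge_itv => // s /andP[_ st].
  by rewrite opprB Kker_ge// subr_ge0.
have md0 : 0 <= m * dt by rewrite mulr_ge0// ltW.
have adt : a <= a + dt by rewrite lerDl ltW.
have := Rintegral_ge_itv _ _ _ _ _ adt md0 inner.
set I := Rintegral _ _ _ => hI.
rewrite -lerBlDl sub0r ler_pdivlMr// mulrC -ler_pdivrMl ?invr_gt0// invrK.
by move: hI; rewrite addrAC subrr add0r; lra.
Qed.

(** * Euclidean product of row vectors *)

Definition rdot {R : realType} {m : nat} (u v : 'rV[R]_m) : R := (u *m v^T) 0 0.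

Section RowDot.
Context {R : realType} {m : nat}.
Implicit Types (u v w : 'rV[R]_m) (k : R).

Lemma rdotE u v : rdot u v = \sum_i u 0 i * v 0 i.
Proof. by rewrite /rdot mxE; apply: eq_bigr => i _; rewrite mxE. Qed.

Lemma rdotC u v : rdot u v = rdot v u.
Proof. by rewrite !rdotE; apply: eq_bigr => i _; rewrite mulrC. Qed.

Lemma rdotDl u v w : rdot (u + v) w = rdot u w + rdot v w.
Proof. by rewrite /rdot mulmxDl mxE. Qed.

Lemma rdotZl k u w : rdot (k *: u) w = k * rdot u w.
Proof. by rewrite /rdot -scalemxAl mxE. Qed.

Lemma rdotDr u v w : rdot w (u + v) = rdot w u + rdot w v.
Proof. by rewrite rdotC rdotDl !(rdotC w). Qed.

Lemma rdotZr k u w : rdot w (k *: u) = k * rdot w u.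
Proof. by rewrite rdotC rdotZl (rdotC w). Qed.

Lemma rdot0 : rdot (0 : 'rV[R]_m) 0 = 0.
Proof. by rewrite /rdot mul0mx mxE. Qed.

Lemma rdot_ge0 u : 0 <= rdot u u.
Proof. by rewrite rdotE; apply: sumr_ge0 => i _; rewrite -expr2 sqr_ge0. Qed.

Lemma sqr_le_rdot u i : u 0 i ^+ 2 <= rdot u u.
Proof.
rewrite rdotE (bigD1 i)//= -expr2 lerDl.
by apply: sumr_ge0 => j _; rewrite -expr2 sqr_ge0.
Qed.

Lemma rdot_eq0 u : rdot u u <= 0 -> u = 0.
Proof.
move=> u0; apply/rowP => i; rewrite mxE; apply/eqP; rewrite -sqrf_eq0 eq_le sqr_ge0 andbT.
exact: le_trans (sqr_le_rdot u i) u0.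
Qed.

Lemma rdot_le2 u v : 2 * rdot u v <= rdot u u + rdot v v.
Proof.
have := rdot_ge0 (u + (-1) *: v).
by rewrite !(rdotDl, rdotDr, rdotZl, rdotZr) (rdotC v u); lra.
Qed.

Lemma rdot_mul_sym (B : 'M[R]_m) u v : B^T = B -> rdot (u *m B) v = rdot u (v *m B).
Proof. by move=> Bs; rewrite /rdot trmx_mul Bs mulmxA. Qed.

End RowDot.

(** * The linear equation with frozen coefficient *)

Section ResolventEquation.
Context {R : realType} {m : nat} (B : 'M[R]_m) (a c : R).
Hypotheses (B_sym : B^T = B) (a_gt0 : 0 < a) (c_ge0 : 0 <= c).
Implicit Types (F U V : 'rV[R]_m) (g : R).

Definition levelmx g : 'M[R]_m := (a + g)%:M + c *: (B *m B).

Lemma mul_levelmx V g : V *m levelmx g = (a + g) *: V + c *: (V *m B *m B).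
Proof. by rewrite /levelmx mulmxDr mul_mx_scalar -scalemxAr mulmxA. Qed.

Lemma levelmx_commute V g : V *m levelmx g *m B = V *m B *m levelmx g.
Proof. by rewrite !mul_levelmx mulmxDl -!scalemxAl. Qed.

(** Pair the equation with [V] and drop [c |V B|^2 >= 0]. Young's inequality on both products on the
    right gives [(a + g) |V|^2 <= a |F|^2 / a^2 + g |U|^2]; dividing by [a + g] yields a bound
    uniform in [g]. *)
Lemma levelmx_bound g F U V : 0 <= g -> V *m levelmx g = F + g *: U ->
  rdot V V <= rdot F F / a ^+ 2 + rdot U U.
Proof.
move=> g0 /(congr1 (rdot V)).
rewrite mul_levelmx !rdotDr !rdotZr -(rdot_mul_sym B V (V *m B)) // => E.
have y0 := mulr_ge0 c_ge0 (rdot_ge0 (V *m B)).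
have hU := ler_wpM2l g0 (rdot_le2 V U).
have := rdot_le2 (a *: V) F; rewrite !(rdotZl, rdotZr) => hF.
move: E y0 hU hF; set x := rdot V V; set y := c * _; set f := rdot V F; set u := rdot V U.
have FE : rdot F F = a ^+ 2 * (rdot F F / a ^+ 2) by rewrite mulrC divfK // expf_neq0 // gt_eqF.
move: FE; set X := _ / _ => FE; set W := rdot U U => E y0 hU hF.
have hF' : 2 * f <= a * x + a * X.
  by rewrite -(ler_pM2l a_gt0); move: hF; rewrite FE expr2; lra.
have W0 := rdot_ge0 U; have X0 : 0 <= X by rewrite divr_ge0 ?rdot_ge0 ?sqr_ge0.
have gX := mulr_ge0 g0 X0; have aW := mulr_ge0 (ltW a_gt0) W0.
have ag : 0 < a + g by rewrite ltr_wpDr.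
by rewrite -(ler_pM2l ag); rewrite -/W in aW; lra.
Qed.

(** A kernel vector solves the equation with zero data, so the a priori bound kills it. *)
Lemma levelmx_unit g : 0 <= g -> levelmx g \in unitmx.
Proof.
move=> g0; rewrite unitmxE unitfE; apply/det0P => -[v v0 vM].
move/eqP: v0; apply; apply: rdot_eq0.
have := @levelmx_bound g 0 0 v g0; rewrite vM scaler0 addr0 => /(_ erefl).
by rewrite rdot0 mul0r addr0.
Qed.

Definition resolvent F U g : 'rV[R]_m := (F + g *: U) *m invmx (levelmx g).

Lemma resolventK F U g : 0 <= g -> resolvent F U g *m levelmx g = F + g *: U.
Proof. by move=> g0; rewrite /resolvent mulmxKV ?levelmx_unit. Qed.

(** Since [B] commutes with the level matrix, [V B] solves the same equation with data [F B], [U B];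
    the a priori bound thus applies to it. *)
Lemma resolvent_mulB F U g : 0 <= g ->
  resolvent F U g *m B *m levelmx g = F *m B + g *: (U *m B).
Proof. by move=> g0; rewrite -levelmx_commute resolventK // mulmxDl -scalemxAl. Qed.

Lemma resolvent_lipschitz F U g g' (D := (resolvent F U g - resolvent F U g') *m B)
    (P := (U - resolvent F U g') *m B) :
  0 <= g -> 0 <= g' -> rdot D D <= (g - g') ^+ 2 * (rdot P P / a ^+ 2).
Proof.
move=> g0 g'0.
(* The difference solves the equation at [g] with data [(g - g') P] and [U = 0]; the term [g *: 0]
   only matches the shape of [levelmx_bound]. *)
have E : D *m levelmx g = (g - g') *: P + g *: 0.
  rewrite scaler0 addr0 /D mulmxBl [LHS]mulmxBl resolvent_mulB //.
  rewrite (_ : levelmx g = levelmx g' + (g - g')%:M); last first.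
    by rewrite /levelmx addrAC -raddfD /= (_ : a + g' + (g - g') = a + g) //; ring.
  rewrite mulmxDr resolvent_mulB // mul_mx_scalar /P mulmxBl.
  move: (F *m B) (U *m B) (_ *m B) => FB UB WB.
  by apply/rowP => i; rewrite !mxE; ring.
have := levelmx_bound _ _ _ _ g0 E.
rewrite rdot0 addr0 rdotZl rdotZr.
by rewrite mulrA -expr2 mulrA.
Qed.

End ResolventEquation.

(** * Continuity and the scalar fixed point *)

(** The Lipschitz estimate is centred at [x], so [k] may depend on [x]. *)
Lemma continuous_lipschitz (R : realType) (h : R -> R) (x k : R) :
  (forall y, `|h x - h y| <= k * `|x - y|) -> (h y @[y --> x] --> h x)%classic.
Proof.
move=> hk; have k1 : 0 < `|k| + 1 by rewrite ltr_pwDr.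
apply/cvgrPdist_lt => e e0; apply/nbhs_ballP; exists (e / (`|k| + 1)).
  by rewrite /= divr_gt0.
move=> y; rewrite /ball /= ltr_pdivlMr // mulrC => xy.
apply: le_lt_trans (hk y) _; apply: le_lt_trans xy.
by rewrite ler_wpM2r // (le_trans (ler_norm _)) // lerDl.
Qed.

Lemma resolvent_scalar_equation (R : realType) (m : nat) (B : 'M[R]_m) (a c k : R)
    (B_sym : B^T = B) (a_gt0 : 0 < a) (c_ge0 : 0 <= c) (k_ge0 : 0 <= k)
    (F U : 'rV[R]_m) (G : R -> R)
    (G_cont : {within `[0, +oo[%classic, continuous G})
    (G_ge0 : forall v, 0 <= v -> 0 <= G v) :
  exists V : 'rV[R]_m,
    a *: V + G (k * rdot (V *m B) (V *m B)) *: (V - U) + c *: (V *m B *m B) = F.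
Proof.
pose V (g : R) := resolvent B a c F U g.
(* The absolute value extends [q] to negative arguments, so that its continuity can be proved on the
   whole line. *)
pose q (g : R) := k * rdot (V `|g| *m B) (V `|g| *m B).
(* The a priori bound for [V B], uniform in [g], multiplied by [k]. *)
pose M := k * (rdot (F *m B) (F *m B) / a ^+ 2 + rdot (U *m B) (U *m B)).
have q0 g : 0 <= q g by rewrite mulr_ge0 ?rdot_ge0.
have qM g : q g <= M.
  rewrite ler_wpM2l //; apply: (levelmx_bound _ _ _ B_sym a_gt0 c_ge0 `|g|) => //.
  exact: resolvent_mulB.
have q_cont : continuous q.
  move=> g; apply: cvgMl_tmp.
  under eq_fun do rewrite rdotE.
  rewrite rdotE; apply: cvg_big => [|i _]; first exact: add_continuous.
  (* The fixed centre [g] takes the place of [g'] in [resolvent_lipschitz], so that [P], and with it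
     [C], is independent of the moving point. *)
  pose P := (U - V `|g|) *m B; pose C := Num.sqrt (rdot P P / a ^+ 2).
  have lip : ((V `|g'| *m B) 0 i @[g' --> g] --> (V `|g| *m B) 0 i)%classic.
    apply: (continuous_lipschitz _ _ _ C) => g'.
    rewrite -(ler_pXn2r (n := 2)) ?nnegrE ?mulr_ge0 ?sqrtr_ge0 //.
    rewrite exprMn sqr_sqrtr ?divr_ge0 ?rdot_ge0 ?sqr_ge0 // mulrC.
    rewrite -normrX ger0_norm ?sqr_ge0 //.
    have := resolvent_lipschitz B a c B_sym a_gt0 c_ge0 F U `|g'| `|g|
      (normr_ge0 _) (normr_ge0 _).
    rewrite -/(V _) -/P => /(le_trans (sqr_le_rdot _ i)).
    rewrite mulmxBl !mxE -[X in X <= _]sqrrN opprB => /le_trans; apply.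
    rewrite ler_wpM2r ?divr_ge0 ?rdot_ge0 ?sqr_ge0 //.
    rewrite -real_normK ?num_real // ler_pXn2r ?nnegrE //.
    by rewrite [leRHS]distrC ler_dist_dist.
  exact: cvgM.
have GM_cont : {within `[0, M]%classic, continuous (fun s => s - q (G s))}.
  have G_contM : {within `[0, M], continuous G}.
    apply: continuous_subspaceW G_cont => x /=.
    by rewrite !in_itv /= andbT => /andP[].
  have qG : {within `[0, M], continuous (q \o G)}.
    by apply: within_continuous_comp G_contM => ? _; exact: q_cont.
  have id_cont : {within `[0, M], continuous (@id R)}.
    by apply: continuous_subspaceT => ?; exact: cvg_id.
  by move=> s; apply: cvgB; [exact: id_cont | exact: qG].
have M0 : 0 <= M by apply: le_trans (qM 0).
(* [s - q (G s)] is nonpositive at 0 because [q >= 0] and nonnegative at [M] because [q <= M]. *)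
have [|s] := IVT M0 GM_cont (v := 0).
  by rewrite ge_min le_max sub0r oppr_le0 q0 subr_ge0 qM orbT.
rewrite in_itv /= => /andP[s0 _] /eqP; rewrite subr_eq0 => /eqP sq.
exists (V (G s)); have Gs0 := G_ge0 _ s0.
have -> : k * rdot (V (G s) *m B) (V (G s) *m B) = s by rewrite [RHS]sq /q ger0_norm.
have := resolventK B a c B_sym a_gt0 c_ge0 F U (G s) Gs0.
rewrite mul_levelmx -/(V _) => /(congr1 (fun X => X - G s *: U)).
rewrite addrK => <-.
move: (V _) (_ *m B *m B) => v w; by apply/rowP => i; rewrite !mxE; ring.
Qed.

(** * Grid differences as a symmetric matrix *)

Section Grid.
Context {R : realType} {m : nat}.
Implicit Types (V W : gvec R m.+1).

Lemma node_ord W (i : 'I_m) : node W i.+1 = W i.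
Proof. by rewrite /node /= insubT //= => lt_im; congr W; apply: val_inj. Qed.

Lemma node_out W k : (m <= k)%N -> node W k.+1 = 0.
Proof. by move=> mk; rewrite /node /= insubF // ltnNge mk. Qed.

(** The default 0 of [node] outside the interior agrees with the boundary values at 0 and [J], so
    all nodes are treated alike. *)
Lemma gext_nat W k : (k <= m.+1)%N -> gext W k%:Z = node W k.
Proof.
move=> km; rewrite /gext eqz_nat ltn_eqF //=.
have [->|k0] //= := eqVneq k 0%N.
have [->|km1] //= := eqVneq k m.+1.
by rewrite node_out.
Qed.

Lemma gext_N1 W : gext W (-1) = - gext W 1.
Proof. by rewrite (gext_nat _ 1). Qed.

Lemma gext_end W : gext W m.+2%:Z = - gext W m%:Z.
Proof. by rewrite (gext_nat _ m) // /gext eqxx. Qed.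

Lemma gext_ord W (i : 'I_m) : gext W i.+1%:Z = W i.
Proof. by rewrite gext_nat ?node_ord // ltnS ltnW. Qed.

Lemma gext0 W : gext W 0 = 0. Proof. by rewrite (gext_nat _ 0). Qed.

Lemma gextJ W : gext W m.+1%:Z = 0. Proof. by rewrite gext_nat // node_out. Qed.

Lemma gext_linear k V W j :
  gext (fun i => k * V i + W i) j = k * gext V j + gext W j.
Proof.
have node_linear n : node (fun i => k * V i + W i) n = k * node V n + node W n.
  rewrite /node; case: ifP => _; last by rewrite mulr0 addr0.
  by case: insub => [i|] //; rewrite mulr0 addr0.
rewrite /gext; case: ifP => _; first by rewrite node_linear opprD mulrN.
case: ifP => _; first by rewrite node_linear opprD mulrN.
by case: j => [n|n]; [case: ifP => _|]; rewrite ?node_linear // mulr0 addr0.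
Qed.

Lemma dxx_linear k V W j :
  dxx (fun i => k * V i + W i) j = k * dxx V j + dxx W j.
Proof. by rewrite /dxx !gext_linear; ring. Qed.

Lemma dxxxx_linear k V W j :
  dxxxx (fun i => k * V i + W i) j = k * dxxxx V j + dxxxx W j.
Proof. by rewrite /dxxxx !gext_linear; ring. Qed.

(** Odd reflection makes the second difference vanish at both end nodes, which agrees with the zero
    extension of [vdxx W]. *)
Lemma gext_vdxx W k : (k <= m.+1)%N -> gext (vdxx W) k%:Z = dxx W k%:Z.
Proof.
case: k => [_|k].
  by rewrite gext0 /dxx add0r sub0r gext_N1 gext0 mulr0 subr0 subrr mul0r.
rewrite ltnS leq_eqVlt => /predU1P[->|km].
  rewrite gextJ /dxx gextJ mulr0 subr0.
  rewrite (_ : m.+1%:Z + 1 = m.+2%:Z); last lia.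
  rewrite (_ : m.+1%:Z - 1 = m%:Z); last lia.
  by rewrite gext_end addNr mul0r.
by rewrite (gext_ord _ (Ordinal km)).
Qed.

(** At an interior node the outer difference reads [dxx W] only at nodes from 0 to [J], where
    [gext_vdxx] applies; the five-point stencil remains. *)
Lemma dxxxx_vdxx W (i : 'I_m) : dxxxx W i.+1%:Z = vdxx (vdxx W) i.
Proof.
have im := ltn_ord i.
have E : vdxx (vdxx W) i = (dxx W i.+2%:Z - 2 * dxx W i.+1%:Z + dxx W i%:Z) / hstep R m.+1 ^+ 2.
  rewrite [LHS]/vdxx [LHS]/dxx.
  rewrite (_ : i.+1%:Z + 1 = i.+2%:Z); last lia.
  rewrite (_ : i.+1%:Z - 1 = i%:Z); last lia.
  by rewrite !gext_vdxx // ?leqW // ltnW.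
rewrite E /dxxxx /dxx.
have -> : i.+1%:Z + 2 = i.+2%:Z + 1 by lia.
have -> : i.+1%:Z + 1 = i.+2%:Z by lia.
have -> : i.+1%:Z - 2 = i%:Z - 1 by lia.
have -> : i.+1%:Z - 1 = i%:Z by lia.
have -> : i.+2%:Z - 1 = i.+1%:Z by lia.
have -> : i%:Z + 1 = i.+1%:Z by lia.
by field; rewrite /hstep invr_eq0 pnatr_eq0.
Qed.

Lemma sum_vdxx_sym V W :
  \sum_(i < m) vdxx V i * W i = \sum_(i < m) V i * vdxx W i.
Proof.
apply/eqP; rewrite -subr_eq0 -sumrB; apply/eqP.
pose v k := gext V k%:Z; pose w k := gext W k%:Z.
(* Discrete Wronskian: its increments are the difference of the two summands, and it vanishes at
   both ends with the boundary values. *)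
pose T k := (v k.+1 * w k - v k * w k.+1) / hstep R m.+1 ^+ 2.
rewrite (eq_bigr (fun i : 'I_m => T i.+1 - T i)) => [|i _].
  rewrite -(big_mkord xpredT (fun i => T i.+1 - T i)) telescope_sumr // /T /v /w.
  by rewrite !gextJ !gext0; ring.
rewrite /vdxx /dxx -!gext_ord /T /v /w.
have -> : i.+1%:Z + 1 = i.+2%:Z by lia.
have -> : i.+1%:Z - 1 = i%:Z by lia.
by ring.
Qed.

Definition vdxx_row (u : 'rV[R]_m) : 'rV[R]_m :=
  \row_i vdxx ((fun j => u 0 j) : gvec R m.+1) i.

Fact vdxx_row_linear : linear vdxx_row.
Proof.
move=> k u v; apply/rowP => i; rewrite !mxE /vdxx -dxx_linear.
by congr (dxx _ _); apply/funext => j; rewrite !mxE.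
Qed.

HB.instance Definition _ :=
  GRing.isLinear.Build R 'rV[R]_m 'rV[R]_m _ vdxx_row vdxx_row_linear.

Definition vdxx_mx : 'M[R]_m := lin1_mx vdxx_row.

Lemma mul_vdxx_mx (u : 'rV[R]_m) i :
  (u *m vdxx_mx) 0 i = vdxx ((fun j => u 0 j) : gvec R m.+1) i.
Proof. by rewrite mul_rV_lin1 mxE. Qed.

(** Summation by parts tested on pairs of basis vectors. *)
Lemma vdxx_mx_sym : vdxx_mx^T = vdxx_mx.
Proof.
have delta_sum (f : 'I_m -> R) (i : 'I_m) : \sum_(k < m) f k * delta_mx 0 i (0 : 'I_1) k = f i.
  rewrite (bigD1 i) //= mxE !eqxx mulr1 big1 ?addr0 // => k ki.
  by rewrite mxE (negPf ki) andbF mulr0.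
apply/matrixP => i j; rewrite mxE !mxE.
have := sum_vdxx_sym (fun k => delta_mx 0 i (0 : 'I_1) k) (fun k => delta_mx 0 j (0 : 'I_1) k).
under [X in _ = X]eq_bigr do rewrite mulrC.
by rewrite !delta_sum.
Qed.

End Grid.

(** * Solving one level, then all levels *)

Lemma FD_step (R : realType) (beta G : R -> R) (f : R -> R -> R)
    (hbeta : admissible_kernel beta) (hK0 : Kker beta 0 < 1) (hG : S1 G)
    (J : nat) (hJ : (0 < J)%N) (dt : R) (hdt : 0 < dt)
    (n : nat) (U : nat -> gvec R J) : (2 <= n)%N ->
  exists V : gvec R J,
    forall i, FD_eq beta G f dt (fun p => if p == n then V else U p) n i.
Proof.
case: J hJ U => // m _ U; case: n => [|[|n]] // _.
pose W := wgt beta dt n.+2; pose w := W n.+2 / dt.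
(* [F] gathers the known terms. The memory term [p = n] splits: its part in [U^n] joins [c] through
   [w], its part in [U^(n-1)] goes into [F]. *)
pose F : 'rV[R]_m := \row_i (f (i.+1%:R * hstep R m.+1) (n.+2%:R * dt)
  - Kker beta (n.+2%:R * dt) * dxxxx (U 0%N) i.+1%:Z
  + (2 * U n.+1 i - U n i) / dt ^+ 2 + w * dxxxx (U n.+1) i.+1%:Z
  - \sum_(1 <= p < n.+2) W p * dxxxx (dtv dt U p) i.+1%:Z).
have [G_cont [G_gt0 _]] := hG.
have Gdt_cont : {within `[0, +oo[, continuous (fun v => G v / dt)}.
  by move=> v; apply: cvgMr_tmp; exact: G_cont.
have Gdt_ge0 v : 0 <= v -> 0 <= G v / dt.
  by move=> v0; rewrite divr_ge0 ?(ltW hdt) // ltW ?G_gt0.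
have a_gt0 : 0 < (dt ^+ 2)^-1 by rewrite invr_gt0 exprn_gt0.
have c_ge0 : 0 <= 1 - Kker beta 0 + w by exact: wgt_diag_ge.
have h_ge0 : 0 <= hstep R m.+1 by rewrite invr_ge0.
have [V hV] := resolvent_scalar_equation R m vdxx_mx _ _ _ vdxx_mx_sym
  a_gt0 c_ge0 h_ge0 F (\row_i U n.+1 i) _ Gdt_cont Gdt_ge0.
pose V' : gvec R m.+1 := fun i => V 0 i.
exists V' => i; rewrite /FD_eq.
have VB : (fun j => (V *m vdxx_mx) 0 j) = vdxx V' by apply/funext => j; rewrite mul_vdxx_mx.
have VBB : (V *m vdxx_mx *m vdxx_mx) 0 i = dxxxx V' i.+1%:Z.
  by rewrite mul_vdxx_mx VB -dxxxx_vdxx.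
have qE : hstep R m.+1 * rdot (V *m vdxx_mx) (V *m vdxx_mx) = gnorm2 (vdxx V').
  by rewrite /gnorm2 /gdot -VB rdotE.
rewrite /= eqxx big_nat_recr //= (ltn_eqF (ltnSn _)) (ltn_eqF (leqnSn _)).
set S := \sum_(1 <= p < n.+2) _.
have SE : S = \sum_(1 <= p < n.+2) W p * dxxxx (dtv dt U p) i.+1%:Z.
  apply: eq_big_nat => p /andP[_ pn]; rewrite /dtv (ltn_eqF pn).
  by rewrite (ltn_eqF (leq_ltn_trans (leq_pred p) pn)).
set D := dtv _ _ _.
have DE : dxxxx D i.+1%:Z = (dxxxx V' i.+1%:Z - dxxxx (U n.+1) i.+1%:Z) / dt.
  (* Writing the new vector as [dt * D + U^(n-1)] puts it in the only form [dxxxx_linear]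
     handles. *)
  have -> : V' = fun j => dt * D j + U n.+1 j.
    apply/funext => j; rewrite /D /dtv /= eqxx (ltn_eqF (ltnSn _)).
    by rewrite mulrC divfK ?subrK // gt_eqF.
  by rewrite dxxxx_linear addrK mulrC mulKf // gt_eqF.
move: hV VBB; rewrite qE; move: (V *m _ *m _) => Z /rowP/(_ i).
rewrite !mxE => + ZE; rewrite ZE SE DE -/W -/(V' i) /w.
by move: (\sum_(1 <= p < _) _) (G _) (W _) => ? ? ?; lra.
Qed.

(** Level [n] reads only levels up to [n]; this lets a solved level pass between histories that
    agree so far. *)
Lemma FD_eq_ext (R : realType) (beta G : R -> R) (f : R -> R -> R) (J : nat) (dt : R)
    (U V : nat -> gvec R J) (n : nat) (i : 'I_J.-1) :
  (forall p, (p <= n)%N -> U p = V p) ->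
  FD_eq beta G f dt U n i -> FD_eq beta G f dt V n i.
Proof.
have n1 := leq_pred n; have n2 : (n.-2 <= n)%N by exact: leq_trans (leq_pred _) n1.
move=> UV; rewrite /FD_eq /= !UV //.
rewrite (eq_big_nat _ _ (F2 := fun p => wgt beta dt n p * dxxxx (dtv dt V p) i.+1%:Z)) //.
move=> p /andP[_ pn]; congr (_ * dxxxx _ _).
by rewrite /dtv (UV p) // (UV p.-1) // (leq_trans (leq_pred p)).
Qed.

(* Each level is computed from the whole history, so the recursion is on
   histories: [hist k] is final on the levels [0, ..., k + 1]. *)
Lemma history_recursion (T : Type) (P : (nat -> T) -> nat -> Prop) (x0 x1 : T) :
  (forall u v n, (forall p, (p <= n)%N -> u p = v p) -> P u n -> P v n) ->
  (forall n u, (2 <= n)%N -> exists x, P (fun p => if p == n then x else u p) n) ->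
  exists u, u 0%N = x0 /\ u 1%N = x1 /\ forall n, (2 <= n)%N -> P u n.
Proof.
move=> Pext step.
have stepS (nu : nat * (nat -> T)) :
    exists x, P (fun p => if p == nu.1.+2 then x else nu.2 p) nu.1.+2.
  exact: step.
have [s hs] := choice stepS.
(* Stage [k'.+1] fills level [k'.+2]; levels not yet reached hold the placeholder [x1]. *)
pose hist := fix hist k := if k is k'.+1 then
    fun p => if p == k'.+2 then s (k', hist k') else hist k' p
  else fun p => if p == 0%N then x0 else x1.
have histS k p : (p <= k.+1)%N -> hist k.+1 p = hist k p.
  by move=> pk; rewrite /= ltn_eqF.
have hist_stable d k p : (p <= k.+1)%N -> hist (k + d)%N p = hist k p.
  move=> pk; elim: d => [|d IH]; first by rewrite addn0.
  by rewrite addnS histS // (leq_trans pk) // ltnS leq_addr.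
(* The diagonal is well chosen because level [p] is already final in [hist p]. *)
exists (fun p => hist p p); split=> //; split=> // -[|[|n]] // _.
apply: (Pext (hist n.+1)); last exact: (hs (n, hist n)).
move=> p; rewrite leq_eqVlt => /predU1P[->|pn].
  by rewrite -(hist_stable 1%N n.+1) // addn1.
by rewrite -(hist_stable (n.+1 - p)%N p) // subnKC // -ltnS.
Qed.

Theorem theorem3p2 (R : realType) (beta G : R -> R) (f : R -> R -> R)
    (hbeta : admissible_kernel beta) (hK0 : Kker beta 0 < 1) (hG : S1 G)
    (J : nat) (hJ : (0 < J)%N) (dt : R) (hdt : 0 < dt) :
  (* stepwise solvability: given U^0, ..., U^{n-1}, (FD) at level n has a solution *)
  (forall (n : nat) (U : nat -> gvec R J), (2 <= n)%N ->
     exists V : gvec R J,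
       forall i : 'I_(J.-1),
         FD_eq beta G f dt (fun m => if m == n then V else U m) n i)
  /\
  (* hence: for any U^0, U^1 there are U^2, U^3, ... solving (FD) at all levels *)
  (forall U0 U1 : gvec R J,
     exists U : nat -> gvec R J,
       U 0%N = U0 /\ U 1%N = U1 /\
       forall n : nat, (2 <= n)%N -> forall i : 'I_(J.-1), FD_eq beta G f dt U n i).
Proof.
have step n U := FD_step _ _ _ f hbeta hK0 hG _ hJ _ hdt n U.
split=> [n U n2|U0 U1]; first exact: step.
apply: (history_recursion _ (fun U n => forall i, FD_eq beta G f dt U n i))
  => [u v n uv hu i|n U n2].
  exact: FD_eq_ext uv (hu i).
exact: step.
Qed.
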